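(* For any $m \geq 0$ and $n\geq 0$, $\#\mathsf{Av}_{\mathbf{m}}(n) = \mathrm{cat}_m(n)$, where $\mathrm{cat}_m(n) := \frac{1}{mn+1}\binom{mn+n}{n}$.
   Context: For an integer $m\geq 0$, $\mathbf{m}$ is the map $\mathbb{N}\setminus\{0\}\to\mathbb{N}$ defined by $\mathbf{m}(i) = (i-1)m$. An $\mathbf{m}$-cliff of size $n$ is a word $u=u_1\cdots u_n$ of nonnegative integers with $u_i\leq \mathbf{m}(i)$ for all $i\in\{1,\dots,n\}$. The set $\mathsf{Av}_{\mathbf{m}}(n)$ of $\mathbf{m}$-avalanches of size $n$ is the set of $\mathbf{m}$-cliffs $u$ of size $n$ such that for all $k\in\{1,\dots,n\}$, $u_1+\cdots+u_k\leq \mathbf{m}(k)$. *)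

(* Defs.v *)
From mathcomp Require Export all_boot all_order all_algebra.
From mathcomp Require Export finmap.
From mathcomp Require Export boolp classical_sets cardinality.

Set Implicit Arguments.
Unset Strict Implicit.
Unset Printing Implicit Defensive.

Import GRing.Theory.

Local Open Scope classical_set_scope.

(* The range map of parameter m; it is only meaningful, and only used, at
   positions i >= 1 (at i = 0 it takes the junk value 0). *)
Definition rangemap (m i : nat) : nat := ((i - 1) * m)%N.

(* Letters are numbered from 1, whereas [nth] counts from 0. *)
Definition letter (u : seq nat) (i : nat) : nat := nth 0%N u (i - 1).

Definition cliffs (m n : nat) : set (seq nat) :=
  [set u | size u = n /\
     forall i : nat, (1 <= i <= n)%N -> (letter u i <= rangemap m i)%N].

Definition avalanches (m n : nat) : set (seq nat) :=
  [set u | cliffs m n u /\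
     forall k : nat, (1 <= k <= n)%N ->
       (\sum_(1 <= i < k.+1) letter u i <= rangemap m k)%N].

(* Rational-valued, so that the quotient is exact division. *)
Definition fuss_catalan (m n : nat) : rat :=
  (1 / (m * n + 1)%N%:R * 'C(m * n + n, n)%:R)%R.

(* Main.v *)
Require Import Defs.
From mathcomp Require Import zify.

(** The condition on prefix sums already forces every letter to be small, so an
    avalanche is a word all of whose prefix sums are bounded by the range map.
    Removing the first letter [a] of such a word leaves a word whose prefix
    sums obey the same bounds shifted by a constant.  This suggests counting,
    for every slack [c], the words of size [n] whose prefix of length [k + 1]
    has sum at most [c + k * m]; avalanches are the case [c = 0].  Let [A n c]
    be their number.  Separating the words that begin with [0] from the others
    (whose first letter can be decremented) gives

      A (n + 1) (c + 1) = A n (c + 1 + m) + A (n + 1) c,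
      A (n + 1) 0 = A n m.

    With [N = n * (m + 1) + c + 1], the solution is the Raney number
    [(c + 1) / N * 'C(N, n)].  In the subtractive form
    ['C(N, n) - (m + 1) * 'C(N - 1, n - 1)] it solves the recurrence merely by
    Pascal's rule applied to both binomials (lemma [size_slack_words]).  At
    [c = 0] it is the Fuss-Catalan number (lemma [size_slack_words0]). *)

Fixpoint slack_words (m n c : nat) : seq (seq nat) :=
  if n is n'.+1 then
    [seq a :: v | a <- iota 0 c.+1, v <- slack_words m n' (c - a + m)]
  else [:: [::]].

Lemma slack_wordsS m n c :
  slack_words m n.+1 c =
  [seq a :: v | a <- iota 0 c.+1, v <- slack_words m n (c - a + m)].
Proof. by []. Qed.

Lemma mem_slack_words m n c v :
  v \in slack_words m n c <->
  size v = n /\ forall k, k < n -> sumn (take k.+1 v) <= c + k * m.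
Proof.
elim: n c v => [|n IHn] c v.
  rewrite inE; split=> [/eqP -> //|[/size0nil -> //]].
rewrite slack_wordsS.
split=> [/allpairsPdep[a [w [+ /IHn[sz_w le_w] ->]]]|[]].
  rewrite mem_iota ltnS => /= le_a_c.
  split=> [|[|k] lt_k] /=; first by rewrite sz_w.
    by rewrite take0 /= addn0 mul0n addn0.
  rewrite mulSn -(subnKC le_a_c) -addnA leq_add2l addnA.
  exact: le_w.
case: v => [//|a w] [sz_w] le_aw.
have le_a_c : a <= c by have := le_aw 0 isT; rewrite /= take0 /=; lia.
apply/allpairsPdep; exists a, w; split=> //; first by rewrite mem_iota; lia.
apply/IHn; split=> // k lt_k.
by have := le_aw k.+1 lt_k; rewrite /= mulSn; lia.
Qed.

Lemma uniq_slack_words m n c : uniq (slack_words m n c).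
Proof.
elim: n c => [//|n IHn] c.
apply: allpairs_uniq_dep => [|a _|]; [exact: iota_uniq | exact: IHn |].
by move=> [a v] [b w] _ _ /= [-> ->].
Qed.

Lemma size_slack_wordsS0 m n :
  size (slack_words m n.+1 0) = size (slack_words m n m).
Proof. by rewrite /= cats0 size_map. Qed.

(** The words that begin with [0] leave a tail of slack [c.+1 + m]; decrementing
    the first letter of the others uses up one unit of slack. *)
Lemma size_slack_wordsSS m n c :
  size (slack_words m n.+1 c.+1) =
  size (slack_words m n (c.+1 + m)) + size (slack_words m n.+1 c).
Proof.
have sizeE d : size (slack_words m n.+1 d) =
    \sum_(0 <= a < d.+1) size (slack_words m n (d - a + m)).
  by rewrite size_allpairs_dep sumnE big_map /index_iota subn0.
by rewrite !sizeE big_nat_recl.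
Qed.

(** ['C(N, n - 1)], with the convention that it vanishes for [n = 0]; truncated
    subtraction would give [1] instead. *)
Definition bin_pred (N n : nat) : nat := if n is k.+1 then 'C(N, k) else 0.

Lemma binS_pred N n : 'C(N.+1, n) = 'C(N, n) + bin_pred N n.
Proof. by case: n => [|n]; rewrite ?bin0 ?binS. Qed.

(** Raney numbers in subtractive form.  Pascal's rule reduces the statement at
    [(n.+1, c.+1)] to those at [(n, c.+1 + m)] and [(n.+1, c)].  At [c = 0] the
    second one is replaced by its value at slack [-1], where the count is zero:
    ['C(N, n.+1) = m.+1 * 'C(N.-1, n)] for [N = n.+1 * m.+1]. *)
Lemma size_slack_words m n c :
  size (slack_words m n c) + m.+1 * bin_pred (n * m.+1 + c) n =
  'C(n * m.+1 + c.+1, n).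
Proof.
elim: n c => [|n IHn] c; first by rewrite muln0 bin0.
elim: c => [|c IHc].
  have := IHn m; rewrite size_slack_wordsS0 [bin_pred _ n.+1]/=.
  rewrite addn0 addn1 binS.
  have -> : n.+1 * m.+1 = (n * m.+1 + m).+1 by rewrite mulSn; lia.
  rewrite addnS => IH.
  have vanish : 'C((n * m.+1 + m).+1, n.+1) = m.+1 * 'C(n * m.+1 + m, n).
    apply/eqP; rewrite -(eqn_pmul2l (ltn0Sn n)) -mul_bin_diag /=; apply/eqP.
    by rewrite mulnA; congr (_ * _); rewrite mulSn; lia.
  have pascal := congr1 (muln m.+1) (binS_pred (n * m.+1 + m) n).
  by rewrite mulnDr in pascal; lia.
have := IHn (c.+1 + m); move: IHc; rewrite size_slack_wordsSS.
have -> : n * m.+1 + (c.+1 + m) = n.+1 * m.+1 + c by rewrite mulSn; lia.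
have -> : n * m.+1 + (c.+1 + m).+1 = (n.+1 * m.+1 + c).+1 by rewrite mulSn; lia.
rewrite [bin_pred _ n.+1]/= [bin_pred (_ + c.+1) _]/= !addnS (binS _.+1).
have pascal := congr1 (muln m.+1) (binS_pred (n.+1 * m.+1 + c) n).
by rewrite mulnDr in pascal; lia.
Qed.

Lemma size_slack_words0 m n :
  (m * n + 1) * size (slack_words m n 0) = 'C(m * n + n, n).
Proof.
case: n => [|n]; first by rewrite muln0 bin0.
have := size_slack_words m n.+1 0.
rewrite [bin_pred _ _]/= addn0 addn1 binS.
have -> : n.+1 * m.+1 = m * n.+1 + n.+1 by rewrite mulnS mulnC addnC.
have := mul_bin_left (m * n.+1 + n.+1) n.
have -> : m * n.+1 + n.+1 - n = m * n.+1 + 1 by lia.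
(* With [B = 'C(N, n)] and [C = 'C(N, n.+1)] for [N = m * n.+1 + n.+1], the size
   is [C - m * B] while [n.+1 * C = (m * n.+1 + 1) * B]; [B] is eliminated. *)
nia.
Qed.

Lemma sum_letters (u : seq nat) k : k <= size u ->
  \sum_(1 <= i < k.+1) letter u i = sumn (take k u).
Proof.
move=> le_k; rewrite sumnE [RHS](big_nth 0) size_takel // big_add1 /=.
by apply: eq_big_nat => i /andP[_ lt_i]; rewrite /letter subn1 nth_take.
Qed.

Local Open Scope classical_set_scope.
Local Open Scope fset_scope.

(** A letter is at most the sum of the prefix that it ends, so the bounds on
    prefix sums give the cliff condition. *)
Lemma avalanchesE m n : avalanches m n = [set` slack_words m n 0].
Proof.
apply/seteqP; split=> u /=.
  move=> [[sz_u _] le_u]; apply/mem_slack_words; split=> // k lt_k.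
  have := le_u k.+1 lt_k.
  by rewrite sum_letters ?sz_u // /rangemap subn1 add0n.
move=> /mem_slack_words[sz_u le_u].
have le_sum k : 1 <= k <= n ->
    \sum_(1 <= i < k.+1) letter u i <= rangemap m k.
  case: k => // k lt_k; rewrite sum_letters ?sz_u // /rangemap subn1.
  exact: le_u.
split=> //; split=> // i i_in.
apply: leq_trans (le_sum i i_in).
have /andP[i_gt0 _] := i_in.
by rewrite big_nat_recr //= leq_addl.
Qed.

Local Open Scope ring_scope.

(* [fset_set] is only meaningful on finite sets, hence the first conjunct. *)
Theorem proposition2p1p2 (m n : nat) :
  finite_set (avalanches m n) /\
  #|` fset_set (avalanches m n)|%:R = fuss_catalan m n.
Proof.
rewrite avalanchesE; split; first exact: finite_seq.
have -> : [set` slack_words m n 0] = [set` [fset v in slack_words m n 0]].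
  by apply/seteqP; split=> v /=; rewrite inE.
rewrite set_fsetK card_fseq undup_id ?uniq_slack_words //.
rewrite /fuss_catalan -size_slack_words0 GRing.natrM GRing.mulrA GRing.mul1r.
by rewrite GRing.mulVf ?GRing.mul1r // addn1 Num.Theory.pnatr_eq0.
Qed.
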